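(* Consider a GMCLP instance $(\mathcal{I},\mathcal{J},(\mathcal{I}_j)_{j\in\mathcal{J}},(w_j)_{j\in\mathcal{J}},p)$ with $\mathcal{N}=\{j\in\mathcal{J}: w_j<0\}$, and let (D$^{+-}$) be the problem obtained from the GMCLP formulation (F) by adding the inequalities $x_j\le x_r$ for all $(j,r)\in\mathcal{A}^{+-}$. Let $(x^*,y^* )$ be an optimal solution of the LP relaxation of (D$^{+-}$) satisfying $$x^*_j=\begin{cases}\max\{\max_{i\in\mathcal{I}_j}y^*_i,\ x^*_{p_j}\}, & j\in\mathcal{N},\\ \min\{y^*(\mathcal{I}_j),\ x^*_{n_j}\}, & j\in\mathcal{J}\setminus\mathcal{N},\end{cases}\qquad\forall\,j\in\mathcal{J},$$ and let $z'_{\mathrm{LP}}$ be the corresponding objective value. Let $$z_{\mathrm{LP}}=\max\Big\{\sum_{j\in\mathcal{N}}w_j\cdot\max_{i\in\mathcal{I}_j}y_i+\sum_{j\in\mathcal{J}\setminus\mathcal{N}}w_j\cdot\min\{1,y(\mathcal{I}_j)\}\ :\ y\in[0,1]^{|\mathcal{I}|},\ y(\mathcal{I})=p\Big\}.$$ Then $$z_{\mathrm{LP}}-z'_{\mathrm{LP}}\ \ge\ \sum_{j\in\mathcal{N}}w_j\cdot\min\Big\{0,\max_{i\in\mathcal{I}_j}y^*_i-x^*_{p_j}\Big\}+\sum_{j\in\mathcal{J}\setminus\mathcal{N}}w_j\cdot\max\big\{\min\{1,y^*(\mathcal{I}_j)\}-x^*_{n_j},\,0\big\}\ \ge\ 0.$$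 Moreover, if (i) $\max_{i\in\mathcal{I}_j}y^*_i<x^*_{p_j}$ for some $j\in\mathcal{N}$, or (ii) $x^*_{n_j}<\min\{1,y^*(\mathcal{I}_j)\}$ and $w_j>0$ for some $j\in\mathcal{J}\setminus\mathcal{N}$, then $z_{\mathrm{LP}}>z'_{\mathrm{LP}}$.
   Context: A GMCLP (generalized maximal covering location problem) instance consists of finite nonempty sets $\mathcal{I}$ (candidate facility locations) and $\mathcal{J}$ (customers), subsets $\mathcal{I}_j\subseteq\mathcal{I}$ for $j\in\mathcal{J}$, real weights $w_j$ for $j\in\mathcal{J}$ (positive or negative), and an integer $p$ with $1\le p\le|\mathcal{I}|$. Put $\mathcal{N}=\{j\in\mathcal{J}: w_j<0\}$. For a vector $a$ and a subset $\mathcal{S}$ of its index set, $a(\mathcal{S})=\sum_{i\in\mathcal{S}}a_i$. A maximum over an empty index set of components $y_i$ is read as $0$. The GMCLP formulation (F) is: maximize $\sum_{j\in\mathcal{J}}w_jx_j$ subject to $y(\mathcal{I})=p$; $y(\mathcal{I}_j)\ge x_j$ for all $j\in\mathcal{J}\setminus\mathcal{N}$; $x_j\ge y_i$ for all $j\in\mathcal{N}$, $i\in\mathcal{I}_j$; $x_j\in\{0,1\}$ for all $j\in\mathcal{J}$; $y_i\in\{0,1\}$ for all $i\in\mathcal{I}$. The LP relaxation of (F), or of (F) with additional linear inequalities, is obtained by replacing $\{0,1\}$ by $[0,1]$ for all variables. Let $\mathcal{A}=\{(j,r): j,r\in\mathcal{J},\ j\ne r,\ \mathcal{I}_j\subseteq\mathcal{I}_r\}$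 and $\mathcal{A}^{+-}=\{(j,r)\in\mathcal{A}: j\in\mathcal{J}\setminus\mathcal{N},\ r\in\mathcal{N}\}$. Given $(x^*,y^* )$: for $j\in\mathcal{N}$ let $\mathcal{P}(j)=\{s\in\mathcal{J}\setminus\mathcal{N}:(s,j)\in\mathcal{A}^{+-}\}$ and let $p_j$ be an element of $\mathcal{P}(j)$ maximizing $x^*_s$ over $s\in\mathcal{P}(j)$, with the convention $p_j=0$ and $x^*_{p_j}=0$ if $\mathcal{P}(j)=\varnothing$; for $j\in\mathcal{J}\setminus\mathcal{N}$ let $\mathcal{N}(j)=\{s\in\mathcal{N}:(j,s)\in\mathcal{A}^{+-}\}$ and let $n_j$ be an element of $\mathcal{N}(j)$ minimizing $x^*_s$ over $s\in\mathcal{N}(j)$, with the convention $n_j=-1$ and $x^*_{n_j}=1$ if $\mathcal{N}(j)=\varnothing$. (The indices $0$ and $-1$ are dummy indices not in $\mathcal{J}$.) *)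

(* Defs.v *)
From HB Require Import structures.
From mathcomp Require Import all_boot all_order all_algebra reals.

Set Implicit Arguments.
Unset Strict Implicit.
Unset Printing Implicit Defensive.

Import Order.TTheory GRing.Theory Num.Theory.
Local Open Scope ring_scope.

(* The set of facilities is nonempty because [1 <= nopen <= #|facility|]. *)
Record gmclp (R : realType) := Gmclp {
  facility : finType;
  customer : finType;
  sites : customer -> {set facility};
  weight : customer -> R;
  nopen : nat;
  customer_gt0 : (0 < #|customer|)%N;
  nopen_bounds : (1 <= nopen <= #|facility|)%N
}.

Definition is_maximum (R : realType) (S : R -> Prop) (z : R) : Prop :=
  S z /\ forall v, S v -> v <= z.

Definition binary {R : realType} : {pred R} := [pred t | (t == 0) || (t == 1)].
Definition unit_interval {R : realType} : {pred R} := [pred t | 0 <= t <= 1].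

Section Formulation.
Variables (R : realType) (G : gmclp R).
Local Notation I := (facility G).
Local Notation J := (customer G).
Implicit Types (x : J -> R) (y : I -> R) (j r : J).

Definition negatives : {set J} := [set j | weight j < 0].

Definition ysum y (S : {set I}) : R := \sum_(i in S) y i.

(* Only used for y >= 0, where the unit 0 of the iterated maximum is harmless
   and yields the convention that a maximum over the empty set is 0. *)
Definition maxover y (S : {set I}) : R := \big[Num.max/0]_(i in S) y i.

Definition objective x : R := \sum_j weight j * x j.

(* [dom] is the range of every variable: [binary] gives the integer programme,
   [unit_interval] its LP relaxation. *)
Definition F_feasible (dom : {pred R}) x y : Prop :=
  [/\ ysum y [set: I] = (nopen G)%:R,
      forall j, j \notin negatives -> x j <= ysum y (sites j),
      forall j i, j \in negatives -> i \in sites j -> y i <= x j,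
      forall j, x j \in dom &
      forall i, y i \in dom].

Definition dominance : {set J * J} :=
  [set jr | (jr.1 != jr.2) && (sites jr.1 \subset sites jr.2)].

Definition dominance_pn : {set J * J} :=
  [set jr in dominance | (jr.1 \notin negatives) && (jr.2 \in negatives)].

Definition Dpn_feasible (dom : {pred R}) x y : Prop :=
  F_feasible dom x y /\ forall j r, (j, r) \in dominance_pn -> x j <= x r.

Definition Dpn_LP_optimal x y : Prop :=
  Dpn_feasible unit_interval x y /\
  forall x' y', Dpn_feasible unit_interval x' y' -> objective x' <= objective x.

Definition Pset j : {set J} :=
  [set s | (s \notin negatives) && ((s, j) \in dominance_pn)].
Definition Nset j : {set J} :=
  [set s in negatives | (j, s) \in dominance_pn].

(* The dummy indices 0 (for p_j) and -1 (for n_j) are both encoded as [None];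
   [value_or d x] extends x by the value d at the dummy index. *)
Definition value_or (d : R) x (o : option J) : R :=
  if o is Some s then x s else d.

Definition argmax_choice x (S : {set J}) (o : option J) : Prop :=
  if o is Some s then s \in S /\ forall t, t \in S -> x t <= x s
  else S = set0.

Definition argmin_choice x (S : {set J}) (o : option J) : Prop :=
  if o is Some s then s \in S /\ forall t, t \in S -> x s <= x t
  else S = set0.

Definition reduced_feasible y : Prop :=
  (forall i, y i \in unit_interval) /\ ysum y [set: I] = (nopen G)%:R.

Definition reduced_objective y : R :=
  \sum_(j in negatives) weight j * maxover y (sites j) +
  \sum_(j in ~: negatives) weight j * Num.min 1 (ysum y (sites j)).

Definition reduced_value (z : R) : Prop :=
  exists2 y, reduced_feasible y & z = reduced_objective y.

End Formulation.

(* Main.v *)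
Require Import Defs.
From HB Require Import structures.
From mathcomp Require Import all_boot all_order all_algebra reals.
From mathcomp Require Import lra.

(** The point y is feasible for the reduced problem that defines zLP, since its
    constraints are among those on (x, y); so zLP is at least the reduced
    objective at y. The theorem then follows from an exact identity,
    [reduced_objective y = objective x + gap], which holds customer by
    customer. The reduced objective gives each customer its best coverage value
    for the fixed y: the maximum of y over its sites when the weight is
    negative, the truncated sum otherwise. The dominance inequalities push x_j
    away from that value, upwards to x_{p_j} for a negative weight
    ([max_add_excess]) and downwards to x_{n_j} for a nonnegative one
    ([min_add_shortfall]), and the terms of the gap are exactly these
    displacements multiplied by the weights.

    Each displacement goes against the sign of its weight, so every term of the
    gap is nonnegative, and a single displacement with a nonzero weight already
    makes the gap positive. *)

Set Implicit Arguments.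
Unset Strict Implicit.
Unset Printing Implicit Defensive.

Import Order.TTheory GRing.Theory Num.Theory.
Local Open Scope ring_scope.

Lemma max_add_excess (R : realDomainType) (m v : R) :
  Num.max m v + Num.min 0 (m - v) = m.
Proof.
rewrite minEle maxEle subr_ge0.
by case: (leP m v) => mv; case: (leP v m) => vm; lra.
Qed.

(** The bound on [v] makes the truncation at 1 harmless: if [v] lies above
    [Num.min 1 m] then [m] itself is below 1 and both sides equal [m]. *)
Lemma min_add_shortfall (R : realDomainType) (m v : R) : v <= 1 ->
  Num.min m v + Num.max (Num.min 1 m - v) 0 = Num.min 1 m.
Proof.
move=> v_le1; rewrite !minEle maxEle subr_le0.
by case: (leP 1 m) => m1; case: (leP m v) => mv; case: (leP 1 v) => v1; lra.
Qed.

Section Gap.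
Variables (R : realType) (G : gmclp R).
Implicit Types (x xp xn : customer G -> R) (y : facility G -> R).
Implicit Types j : customer G.

(** In the application [xp j] and [xn j] are the values of x at the indices p_j
    and n_j, dummy indices included. *)
Definition excess_term y xp j : R :=
  weight j * Num.min 0 (maxover y (sites j) - xp j).
Definition shortfall_term y xn j : R :=
  weight j * Num.max (Num.min 1 (ysum y (sites j)) - xn j) 0.
Definition gap y xp xn : R :=
  \sum_(j in negatives G) excess_term y xp j +
  \sum_(j in ~: negatives G) shortfall_term y xn j.

(** Both objectives are sums over customers, and the two identities on minima
    and maxima match them customer by customer. *)
Lemma reduced_objective_eq x y xp xn :
    (forall j, j \in negatives G -> x j = Num.max (maxover y (sites j)) (xp j)) ->
    (forall j, j \notin negatives G -> x j = Num.min (ysum y (sites j)) (xn j)) ->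
    (forall j, xn j <= 1) ->
  reduced_objective y = objective x + gap y xp xn.
Proof.
move=> xN xP xn_le1.
have -> : objective x = \sum_(j in negatives G) weight j * x j +
                        \sum_(j in ~: negatives G) weight j * x j.
  rewrite /objective (bigID (mem (negatives G))) /=; congr (_ + _).
  by apply: eq_bigl => j; rewrite !inE.
rewrite /gap addrACA -!big_split /=; congr (_ + _).
  by apply: eq_bigr => j jN; rewrite -mulrDr xN // max_add_excess.
apply: eq_bigr => j; rewrite inE => jP.
by rewrite -mulrDr xP // min_add_shortfall.
Qed.

Lemma excess_term_ge0 y xp j : j \in negatives G -> 0 <= excess_term y xp j.
Proof. by rewrite inE => /ltW w_le0; rewrite mulr_le0 // ge_min lexx. Qed.

Lemma shortfall_term_ge0 y xn j :
  j \in ~: negatives G -> 0 <= shortfall_term y xn j.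
Proof. by rewrite !inE -leNgt => w_ge0; rewrite mulr_ge0 // le_max lexx orbT. Qed.

Lemma gap_ge0 y xp xn : 0 <= gap y xp xn.
Proof.
by apply: addr_ge0; apply: sumr_ge0 => j;
  [apply: excess_term_ge0 | apply: shortfall_term_ge0].
Qed.

Lemma gap_gt0_excess y xp xn j :
  j \in negatives G -> maxover y (sites j) < xp j -> 0 < gap y xp xn.
Proof.
move=> jN m_lt; apply: ltr_wpDr.
  by apply: sumr_ge0 => k; apply: shortfall_term_ge0.
rewrite (bigD1 j) //=; apply: ltr_wpDr.
  by apply: sumr_ge0 => k /andP[kN _]; apply: excess_term_ge0.
by rewrite nmulr_rgt0 ?gt_min ?subr_lt0 ?m_lt ?orbT //; rewrite inE in jN.
Qed.

Lemma gap_gt0_shortfall y xp xn j : 0 < weight j ->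
  xn j < Num.min 1 (ysum y (sites j)) -> 0 < gap y xp xn.
Proof.
move=> w_gt0 m_gt; apply: ltr_wpDl.
  by apply: sumr_ge0 => k; apply: excess_term_ge0.
have jP : j \in ~: negatives G by rewrite !inE -leNgt ltW.
rewrite (bigD1 j) //=; apply: ltr_wpDr.
  by apply: sumr_ge0 => k /andP[kP _]; apply: shortfall_term_ge0.
by rewrite mulr_gt0 // lt_max subr_gt0 m_gt.
Qed.

End Gap.

Theorem theorem4p4 (R : realType) (G : gmclp R)
  (x : customer G -> R) (y : facility G -> R)
  (pj nj : customer G -> option (customer G)) (zLP : R)
  (hopt : Dpn_LP_optimal x y)
  (hpj : forall j, j \in negatives G -> argmax_choice x (Pset j) (pj j))
  (hnj : forall j, j \notin negatives G -> argmin_choice x (Nset j) (nj j))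
  (hxN : forall j, j \in negatives G ->
     x j = Num.max (maxover y (sites j)) (value_or 0 x (pj j)))
  (hxP : forall j, j \notin negatives G ->
     x j = Num.min (ysum y (sites j)) (value_or 1 x (nj j)))
  (hzLP : is_maximum (@reduced_value R G) zLP) :
  let gap :=
    \sum_(j in negatives G)
       weight j * Num.min 0 (maxover y (sites j) - value_or 0 x (pj j)) +
    \sum_(j in ~: negatives G)
       weight j * Num.max (Num.min 1 (ysum y (sites j)) - value_or 1 x (nj j)) 0 in
  [/\ zLP - objective x >= gap,
      gap >= 0 &
      (exists2 j, j \in negatives G &
         maxover y (sites j) < value_or 0 x (pj j)) \/
      (exists2 j, j \notin negatives G &
         value_or 1 x (nj j) < Num.min 1 (ysum y (sites j)) /\ 0 < weight j) ->
      zLP > objective x].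
Proof.
have [[[ysumE _ _ x01 y01] _] _] := hopt.
pose xp j := value_or 0 x (pj j); pose xn j := value_or 1 x (nj j).
have xn_le1 j : xn j <= 1.
  (* The dummy index has value 1, and a genuine one has its value in [0, 1]. *)
  by rewrite /xn; case: (nj j) => [s|] //=; have /andP[] := x01 s.
have red_le : reduced_objective y <= zLP by apply: hzLP.2; exists y.
rewrite (reduced_objective_eq hxN hxP xn_le1) in red_le.
move=> gap0; rewrite -[gap0]/(gap y xp xn).
split; first by rewrite lerBrDl.
  exact: gap_ge0.
move=> disp; apply: lt_le_trans red_le; rewrite ltrDl.
case: disp => [[j jN m_lt] | [j _ [m_gt w_gt0]]].
  exact: gap_gt0_excess jN m_lt.
exact: gap_gt0_shortfall w_gt0 m_gt.
Qed.
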